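(* Let $s = p_1\cdots p_m$ be a product of distinct primes and let $\mathbb{F}_i = \prod_{j \in \{1,\dots,m\}\setminus\{i\}} \mathbb{Z}_{p_j}$ for $1\le i\le m$. Let $\mathcal{L}(\mathbb{Z}_s,+)$ be the lattice of all clones on $\mathbb{Z}_s$ containing $\mathrm{Clo}(\mathbb{Z}_s,+)$, and let $\mathcal{L}(\mathbb{Z}_{p_i},\mathbb{F}_i)$ be the lattice of all $(\mathbb{Z}_{p_i},\mathbb{F}_i)$-linearly closed clonoids. Then $$\sum_{i=1}^m|\mathcal{L}(\mathbb{Z}_{p_i},\mathbb{F}_i)| - m + 1\;\leq\; |\mathcal{L}(\mathbb{Z}_{s},+)| \;\leq\; \prod_{i=1}^m|\mathcal{L}(\mathbb{Z}_{p_i},\mathbb{F}_i)|^{p_i+1}.$$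
   Context: $\mathbb{N}=\{1,2,3,\dots\}$. A clone on a set $A$ is a set of finitary functions $A^n\to A$ ($n\in\mathbb{N}$) containing all projections and closed under composition. $\mathrm{Clo}(\mathbb{Z}_s,+)$ is the clone on $\mathbb{Z}_s$ generated by the addition. Linearly closed clonoids: let $p$ be a prime and let $\mathbb{K}=\prod_{j\in J}\mathbb{Z}_{q_j}$ be a finite product of prime fields (for $J=\emptyset$, $\mathbb{K}$ is a one-element set). An element of $\mathbb{K}^n$ is written as $(\mathbf{x}_j)_{j\in J}$ with $\mathbf{x}_j\in\mathbb{Z}_{q_j}^n$. For a set $C$ of functions, $C^{[n]}$ denotes the set of its $n$-ary members. A $(\mathbb{Z}_p,\mathbb{K})$-linearly closed clonoid is a non-empty set $C$ of functions $f\colon\mathbb{K}^n\to\mathbb{Z}_p$ ($n\in\mathbb{N}$ arbitrary) such that: (1) for all $n\in\mathbb{N}$, $f,g\in C^{[n]}$ and $a,b\in\mathbb{Z}_p$, $af+bg\in C^{[n]}$; (2) for all $l,n\in\mathbb{N}$, $f\in C^{[n]}$ and matrices $A_j\in\mathbb{Z}_{q_j}^{n\times l}$ ($j\in J$), the function $\mathbb{K}^l\to\mathbb{Z}_p$, $(\mathbf{x}_j)_{j\in J}\mapsto f((A_j\cdot\mathbf{x}_j^t)_{j\in J})$ is in $C^{[l]}$. *)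

(* Defs.v *)
From mathcomp Require Import all_boot all_order all_algebra.
From mathcomp Require Import finmap.
From mathcomp Require Import all_classical.

Set Implicit Arguments.
Unset Strict Implicit.
Unset Printing Implicit Defensive.

Import GRing.Theory.
Local Open Scope ring_scope.
Local Open Scope classical_set_scope.

(* Functions D n -> B for all arities n >= 1: the tag n of an element stands
   for the arity n.+1.  Keeping the arity as a tag matters when the sets D n
   are indistinguishable (e.g. singletons). *)
Definition fop (D : nat -> finType) (B : finType) : Type :=
  {n : nat & {ffun D n.+1 -> B}}.

(* members C n is C^[n+1], the set of the (n+1)-ary members of C. *)
Definition members (D : nat -> finType) (B : finType) (C : set (fop D B))
    (n : nat) : set {ffun D n.+1 -> B} :=
  [set f | C (existT (fun n => {ffun D n.+1 -> B}) n f)].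
Arguments members {D B} C n _.

Section Clones.
Variable A : finType.

Definition power (n : nat) : finType := {ffun 'I_n -> A}.

Definition projection (n : nat) (i : 'I_n) : {ffun power n -> A} :=
  [ffun x : power n => x i].

Definition composition (n l : nat) (f : {ffun power n -> A})
    (g : 'I_n -> {ffun power l -> A}) : {ffun power l -> A} :=
  [ffun x : power l => f [ffun i => g i x]].

Definition clone (C : set (fop power A)) : Prop :=
  (forall (n : nat) (i : 'I_n.+1), members C n (projection i)) /\
  (forall (n l : nat) (f : {ffun power n.+1 -> A})
      (g : 'I_n.+1 -> {ffun power l.+1 -> A}),
    members C n f -> (forall i, members C l (g i)) ->
    members C l (composition f g)).

Definition Clo (G : set (fop power A)) : set (fop power A) := smallest clone G.

End Clones.

Definition addop (V : finZmodType) : fop (power V) V :=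
  existT (fun n => {ffun power V n.+1 -> V}) 1%N
    [ffun x : power V 2 => x 0 + x 1].

(* 'Z_s is the ring of integers modulo s only for s > 1. *)
Definition clones_above_addition (s : nat) : set (set (fop (power 'Z_s) 'Z_s)) :=
  [set C | clone C /\ Clo [set addop 'Z_s] `<=` C].
Arguments clones_above_addition s _ : clear implicits.

Section Clonoids.
(* 'F_p and 'F_(q j) are Z_p and Z_(q j) only for prime p and q j. *)
Variables (p : nat) (J : finType) (q : J -> nat).

(* K^n for K = \prod_(j in J) Z_(q j), in the form (x_j)_(j in J) with
   x_j in Z_(q j)^n a column vector. *)
Definition prodspace (n : nat) : finType :=
  {dffun forall j : J, 'cV['F_(q j)]_n}.

Definition linear_subst (n l : nat) (f : {ffun prodspace n -> 'F_p})
    (A : forall j : J, 'M['F_(q j)]_(n, l)) : {ffun prodspace l -> 'F_p} :=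
  [ffun x : prodspace l =>
     f ([ffun j => A j *m x j] : {dffun forall j : J, 'cV['F_(q j)]_n})].

Definition linearly_closed_clonoid (C : set (fop prodspace 'F_p)) : Prop :=
  [/\ C !=set0,
      forall (n : nat) (f g : {ffun prodspace n.+1 -> 'F_p}) (a b : 'F_p),
        members C n f -> members C n g ->
        members C n [ffun x => a * f x + b * g x]
    & forall (l n : nat) (f : {ffun prodspace n.+1 -> 'F_p})
        (A : forall j : J, 'M['F_(q j)]_(n.+1, l.+1)),
        members C n f -> members C l (linear_subst f A)].

End Clonoids.
Arguments linearly_closed_clonoid p {J} q C.

(* The (Z_(p i), F_i)-linearly closed clonoids, where F_i is the product of
   the Z_(p j) over all j distinct from i. *)
Definition clonoids_at (m : nat) (p : 'I_m -> nat) (i : 'I_m) :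
    set (set (fop (prodspace (fun j : {j : 'I_m | j != i} => p (val j)))
                  'F_(p i))) :=
  [set C | linearly_closed_clonoid (p i)
             (fun j : {j : 'I_m | j != i} => p (val j)) C].
Arguments clonoids_at {m} p i _.

(* Number of elements of a finite set; the value 0 on infinite sets is junk. *)
Definition cardset (T : choiceType) (A : set T) : nat := #|` fset_set A|%fset.

(* Main.v *)
(* By the Chinese remainder theorem a clone C above the addition is the direct
   sum of its parts with values in Z_{p_i}. Write such a part f as a polynomial
   in the Z_{p_i}-components x of the arguments whose coefficients depend on the
   other components y. Substitutions that are linear in x extract from f the
   functions z_1 ... z_d g(y), where g runs over the coefficients of the
   monomials of degree d, and f is a sum of specializations of these. So C is
   determined by the clonoids D_{i,d} of all g with z_1 ... z_d g(y) in C. As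
   z^p = z, and as g^p = g is reached by composition, D_{i,d} = D_{i,d+p_i-1}
   for d >= 2. Hence the D_{i,d} with d <= p_i suffice, which gives the upper
   bound.

   For the lower bound, a clonoid M at i yields the clone of all
   a_1 x_1 + ... + a_n x_n + g(y) with g in M. These clones are pairwise
   distinct, except that the zero clonoids all yield the clone of the linear
   functions.

   A clonoid is determined by its unary members, hence there are finitely many:
   when q is invertible in Z_p, every function h from column vectors over F_q to
   Z_p satisfies h(x) = sum_A c(A) h(A x) over the matrices A of rank at most 1,
   with coefficients c(A) that do not depend on h and x. *)

Require Import Defs.
From mathcomp Require Import all_boot all_order all_algebra.
From mathcomp Require Import zify finfield finmap all_classical.
(* all_classical shadows the dfwith of eqtype. *)
From mathcomp Require Import eqtype.

Set Implicit Arguments.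
Unset Strict Implicit.
Unset Printing Implicit Defensive.

Import GRing.Theory.
Local Open Scope ring_scope.

(** * Clonoids are determined by their unary parts *)

Section OuterProduct.
Variables (F : finFieldType) (k : fieldType) (n : nat).
Implicit Types (x z : 'cV[F]_n) (v w : 'rV[F]_n).

Definition pairing v x : F := (v *m x) 0 0.

Lemma pairingDl v w x : pairing (v + w) x = pairing v x + pairing w x.
Proof. by rewrite /pairing mulmxDl mxE. Qed.

Lemma pairingZl a v x : pairing (a *: v) x = a * pairing v x.
Proof. by rewrite /pairing -scalemxAl mxE. Qed.

Lemma pairing0 v : pairing v 0 = 0.
Proof. by rewrite /pairing mulmx0 mxE. Qed.

Lemma pairing_delta i x : pairing (delta_mx 0 i) x = x i 0.
Proof. by rewrite /pairing -rowE mxE. Qed.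

Lemma pairing_surj x : x != 0 -> exists v, pairing v x = 1.
Proof.
move=> x0; have [i xi] : exists i, x i 0 != 0.
  apply/existsP; apply: contra_neqT x0 => /existsPn x0.
  apply/matrixP => i j; rewrite mxE ord1.
  by apply/eqP; move: (x0 i); rewrite negbK.
exists ((x i 0)^-1 *: delta_mx 0 i).
by rewrite pairingZl pairing_delta mulVf.
Qed.

Lemma pairing_inj x z : (forall v, pairing v x = pairing v z) -> x = z.
Proof.
by move=> E; apply/matrixP => i j; rewrite ord1 -!pairing_delta E.
Qed.

Lemma mul_outer z v x : z *m v *m x = pairing v x *: z.
Proof. by rewrite -mulmxA [v *m x]mx11_scalar mul_mx_scalar. Qed.

Lemma trace_outer z v : \tr (z *m v) = pairing v z.
Proof. by rewrite mxtrace_mulC /mxtrace big_ord1. Qed.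

(** Translation along a w with w x = 1 carries the fibre over 1 onto every other fibre, so the
    [#|F|] fibres have equal size. *)
Lemma card_pairing1 x : x != 0 ->
  (#|[pred v | pairing v x == 1%R]| * #|F| = #|F| ^ n)%N.
Proof.
move=> x0; have [w wx] := pairing_surj x0.
have -> : (#|F| ^ n)%N = #|{: 'rV[F]_n}| by rewrite card_mx mul1n.
rewrite -[RHS]sum1_card (partition_big (fun v => pairing v x) predT) //=.
rewrite mulnC -sum_nat_const; apply: eq_bigr => c _.
rewrite (reindex_inj (addrI ((c - 1) *: w))) /= -sum1_card; apply: eq_bigl => v.
by rewrite pairingDl pairingZl wx mulr1 inE -(inj_eq (addrI (c - 1)) _ 1) subrK.
Qed.

(* If some w kills x but not z, translation by w balances the two conditions on
   z; otherwise v z is the same for all v with v x = 1, and it is neither 0 nor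
   1 unless z = x. *)
Lemma sum_pairing x z : x != 0 -> z != 0 ->
  \sum_(v | pairing v x == 1) ((pairing v z == 1)%:R - (pairing v z == 0)%:R)
  = (x == z)%:R * #|[pred v | pairing v x == 1]|%:R :> k.
Proof.
move=> x0 z0; have [<-|xz] := eqVneq x z.
  rewrite mul1r -sum1_card natr_sum; apply: eq_bigr => v /eqP ->.
  by rewrite eqxx oner_eq0 subr0.
rewrite mul0r; have [/existsP[w /andP[/eqP wx wz]]|/existsPn K] :=
    boolP [exists w, (pairing w x == 0) && (pairing w z != 0)].
  rewrite big_split /= sumrN.
  apply/eqP; rewrite subr_eq0; apply/eqP.
  pose u := (pairing w z)^-1 *: w.
  rewrite (reindex_inj (addIr u)); apply: eq_big => v.
    by rewrite pairingDl pairingZl wx mulr0 addr0.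
  move=> _; rewrite pairingDl pairingZl mulVf //.
  by rewrite -subr_eq0 addrK.
have {}K w : pairing w x = 0 -> pairing w z = 0.
  by move=> wx; move: (K w); rewrite wx eqxx /= negbK => /eqP.
have [v0 v0x] := pairing_surj x0.
have E v : pairing v z = pairing v x * pairing v0 z.
  apply/eqP; rewrite -subr_eq0 -mulNr -pairingZl -pairingDl; apply/eqP/K.
  by rewrite pairingDl pairingZl v0x mulr1 subrr.
apply: big1 => v /eqP vx; rewrite E vx mul1r.
case: eqP => [e1|_]; first case/eqP: xz.
  by apply: pairing_inj => w; rewrite E e1 mulr1.
case: eqP => [e0|_]; last by rewrite subrr.
by case/eqP: z0; apply: pairing_inj => w; rewrite E e0 mulr0 pairing0.
Qed.

(** The matrices of rank at most 1, in the factored form that lets a substitution pass through a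
    unary function. *)
Definition outer_product (A : 'M[F]_n) : bool :=
  [exists z : 'cV_n, exists v : 'rV_n, A == z *m v].

Lemma outer_product0 : outer_product 0.
Proof. by apply/existsP; exists 0; apply/existsP; exists 0; rewrite mulmx0. Qed.

(** If u v x = z, then u is proportional to z; moving the scalar to the row factor normalizes it to
    v x = 1. *)
Lemma outer_image x z : x != 0 -> z != 0 ->
  [set A | [&& outer_product A, A != 0 & A *m x == z]] =
  [set z *m v | v in [set v | pairing v x == 1]].
Proof.
move=> x0 z0; apply/setP => A; rewrite !inE; apply/idP/imsetP.
  case/and3P => /existsP[u /existsP[v /eqP ->]] uv0 /eqP e.
  move: e z0; rewrite mul_outer => <-.
  rewrite scaler_eq0 negb_or => /andP[c0 _].
  exists ((pairing v x)^-1 *: v).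
    by rewrite inE pairingZl mulVf.
  by rewrite -scalemxAl -scalemxAr scalerA mulfV // scale1r.
case=> v; rewrite inE => /eqP vx ->; rewrite mul_outer vx scale1r eqxx andbT.
apply/andP; split; first by apply/existsP; exists z; apply/existsP; exists v.
apply: contra_neq z0 => zv; by rewrite -[z]scale1r -vx -mul_outer zv mul0mx.
Qed.

(* Away from 0 the coefficient of A is q^(1 - n) ([tr A = 1] - [tr A = 0]) with
   q = #|F|; the coefficient of 0 makes the sum of all coefficients equal 1. *)
Lemma outer_product_identity : #|F|%:R != 0 :> k ->
  exists c : 'M[F]_n -> k, forall (h : 'cV[F]_n -> k) x,
    h x = \sum_(A | outer_product A) c A * h (A *m x).
Proof.
move=> q0; pose N : k := #|F|%:R ^+ n / #|F|%:R.
have N0 : N != 0 by rewrite mulf_neq0 ?expf_neq0 ?invr_eq0.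
pose b (A : 'M[F]_n) : k := N^-1 * ((\tr A == 1)%:R - (\tr A == 0)%:R).
pose c0 := 1 - \sum_(A | outer_product A && (A != 0)) b A.
exists (fun A => if A == 0 then c0 else b A) => h x.
(* All coefficients together sum to 1, so h may be replaced by h - h 0, to which the zero matrix
   contributes nothing. *)
suff key : h x - h 0 =
    \sum_(A | outer_product A && (A != 0)) b A * (h (A *m x) - h 0).
  rewrite (bigD1 0) ?outer_product0 //= eqxx mul0mx mulrBl mul1r mulr_suml.
  under [X in _ + X]eq_bigr => A /andP[_ /negPf ->] do [].
  rewrite -addrA [- _ + _]addrC -sumrB; under eq_bigr do rewrite -mulrBr.
  by rewrite -key addrC subrK.
have [->|x0] := eqVneq x 0.
  by rewrite subrr big1 // => A _; rewrite mulmx0 subrr mulr0.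
(* Grouped by the value z of A x, the coefficients must add up to 1 for z = x and to 0 for every
   other nonzero z. *)
rewrite (partition_big (fun A => A *m x) predT) //=.
rewrite (bigD1 0) //= big1 ?add0r; last first.
  by move=> A /andP[_ /eqP ->]; rewrite subrr mulr0.
transitivity (\sum_(z | z != 0) (h z - h 0) * (x == z)%:R).
  symmetry; rewrite (bigD1 x) //= eqxx mulr1 big1 ?addr0 // => z /andP[_].
  by move=> /negPf zx; rewrite eq_sym zx mulr0.
symmetry; apply: eq_bigr => z z0.
transitivity ((h z - h 0) *
  \sum_(A in [set A | [&& outer_product A, A != 0 & A *m x == z]]) b A).
  rewrite mulr_sumr; apply: eq_big => A; first by rewrite inE andbA.
  by case/andP => _ /eqP ->; rewrite mulrC.
rewrite outer_image // big_imset /=; last first.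
  move=> v w _ _ zvw; apply/rowP => i.
  have [u uz] := pairing_surj z0.
  have := congr1 (fun B => (u *m B) 0 i) zvw; rewrite !mulmxA.
  by rewrite [u *m z]mx11_scalar -/(pairing u z) uz !mul_scalar_mx !scale1r.
congr (_ * _).
transitivity (N^-1 * \sum_(v | pairing v x == 1)
   ((pairing v z == 1)%:R - (pairing v z == 0)%:R)).
  rewrite mulr_sumr; apply: eq_big => v; rewrite ?inE // => _.
  by rewrite /b trace_outer.
rewrite sum_pairing // mulrCA -[RHS]mulr1; congr (_ * _).
have -> : #|[pred v | pairing v x == 1]|%:R = N.
  by rewrite /N -natrX -(card_pairing1 x0) natrM mulfK.
by rewrite mulVf.
Qed.
End OuterProduct.

(** * Reduction of clonoids to unary functions *)

Section UnaryPart.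
Variables (p : nat) (J : finType) (q : J -> nat).
Local Notation K n := (prodspace q n).

Lemma linear_subst_comp n l k (f : {ffun K n -> 'F_p})
    (A : forall j, 'M['F_(q j)]_(n, l)) (B : forall j, 'M['F_(q j)]_(l, k)) :
  linear_subst (linear_subst f A) B = linear_subst f (fun j => A j *m B j).
Proof.
apply/ffunP => x; rewrite !ffunE; congr (f _); apply/ffunP => j.
by rewrite !ffunE mulmxA.
Qed.

Lemma linear_subst1 n (f : {ffun K n -> 'F_p}) :
  linear_subst f (fun j => 1%:M) = f.
Proof.
apply/ffunP => x; rewrite !ffunE; congr (f _); apply/ffunP => j.
by rewrite !ffunE mul1mx.
Qed.

Variable C : set (fop (prodspace q) 'F_p).
Hypothesis clC : linearly_closed_clonoid p q C.

Lemma clonoid0 n : members C n [ffun=> 0].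
Proof.
case: clC => -[[k f] Cf] lin subst.
have Cf0 := lin k f f 0 0 Cf Cf.
have := subst n k _ (fun j => 0) Cf0.
by congr (members C n _); apply/ffunP => x; rewrite !ffunE !mul0r addr0.
Qed.

Lemma clonoidD n (f g : {ffun K n.+1 -> 'F_p}) :
  members C n f -> members C n g -> members C n [ffun x => f x + g x].
Proof.
case: clC => _ lin _ Cf Cg; have := lin n f g 1 1 Cf Cg.
by congr (members C n _); apply/ffunP => x; rewrite !ffunE !mul1r.
Qed.

Lemma clonoidZ n a (f : {ffun K n.+1 -> 'F_p}) :
  members C n f -> members C n [ffun x => a * f x].
Proof.
case: clC => _ lin _ Cf; have := lin n f f a 0 Cf Cf.
by congr (members C n _); apply/ffunP => x; rewrite !ffunE !mul0r addr0.
Qed.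

Lemma clonoid_sum n (I : Type) (r : seq I) (P : pred I) (c : I -> 'F_p)
    (f : I -> {ffun K n.+1 -> 'F_p}) :
  (forall i, P i -> members C n (f i)) ->
  members C n [ffun x => \sum_(i <- r | P i) c i * f i x].
Proof.
move=> Cf; elim: r => [|i r IH].
  have -> : [ffun x => \sum_(i <- [::] | P i) c i * f i x] = [ffun=> 0].
    by apply/ffunP => x; rewrite !ffunE big_nil.
  exact: clonoid0.
have [Pi|nPi] := boolP (P i).
  have := clonoidD (clonoidZ (c i) (Cf i Pi)) IH.
  by congr (members C n _); apply/ffunP => x; rewrite !ffunE big_cons Pi.
by move: IH; congr (members C n _); apply/ffunP => x;
  rewrite !ffunE big_cons (negPf nPi).
Qed.

Hypothesis p_pr : prime p.
Hypothesis q_pr : forall j, prime (q j).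
Hypothesis q_neq : forall j, q j != p.

(** The identity for outer products, applied in one component at a time, reduces all matrices to
    rank at most 1; the substitution then passes through a unary member. *)
Lemma unary_part n (f : {ffun K n.+1 -> 'F_p}) :
  (forall u : forall j, 'M['F_(q j)]_(n.+1, 1),
     members C 0 (linear_subst f u)) -> members C n f.
Proof.
move=> Cf.
(* s lists the components whose matrices may still have arbitrary rank. *)
suff Q (s : seq J) (A : forall j, 'M['F_(q j)]_n.+1) :
    (forall j, j \notin s -> outer_product (A j)) ->
    members C n (linear_subst f A).
  rewrite -[f]linear_subst1; apply: (Q (enum J)) => j.
  by rewrite mem_enum.
elim: s A => [|j s IH] A oA.
  have /fin_all_exists[u /fin_all_exists[v Auv]] :
      forall j, exists u : 'cV_n.+1, exists v : 'rV_n.+1, A j = u *m v.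
    move=> j; have /existsP[u /existsP[v /eqP ->]] := oA j isT.
    by exists u, v.
  have -> : A = (fun j => u j *m v j) by apply/functional_extensionality_dep.
  by rewrite -linear_subst_comp; case: clC => _ _; apply; apply: Cf.
have qp : #|'F_(q j)|%:R != 0 :> 'F_p.
  rewrite card_Fp // -(dvdn_pcharf (pchar_Fp p_pr)) dvdn_prime2 //.
  by rewrite eq_sym.
have [c cE] := outer_product_identity n.+1 qp.
have := @clonoid_sum n _ (index_enum 'M['F_(q j)]_n.+1)
  (@outer_product _ _) c (fun B => linear_subst f (dfwith A (A j *m B))) _.
have -> : [ffun x => \sum_(B | outer_product B)
    c B * linear_subst f (dfwith A (A j *m B)) x] = linear_subst f A.
  apply/ffunP => x; rewrite !ffunE.
  (* Only the j-th component varies here; the others stay fixed. *)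
  pose h (t : 'cV['F_(q j)]_n.+1) := f [ffun k => A k *m dfwith x t k].
  transitivity (h (x j)).
    rewrite cE; apply: eq_bigr => B _; congr (_ * _); rewrite /h ffunE.
    congr (f _); apply/ffunP => k; rewrite !ffunE.
    case: dfwithP => [|k' jk']; last by rewrite dfwith_out.
    by rewrite dfwith_in mulmxA.
  rewrite /h; congr (f _); apply/ffunP => k; rewrite !ffunE.
  by case: dfwithP.
apply=> B oB; apply: IH => k; case: dfwithP => [_|k' jk' k's]; last first.
  by apply: oA; rewrite inE negb_or eq_sym jk'.
have /existsP[u /existsP[v /eqP ->]] := oB.
by apply/existsP; exists (A j *m u); apply/existsP; exists v; rewrite mulmxA.
Qed.
End UnaryPart.

(** * Counting by injections; finiteness of the set of clonoids *)

Lemma finite_set_inj (T : choiceType) (U : finType) (A : set T) (f : T -> U) :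
  {in A &, injective f} -> finite_set A /\ (cardset A <= #|U|)%N.
Proof.
move=> f_inj.
have finA : finite_set A.
  by rewrite -(eq_finite_set (inj_card_eq f_inj)); exact: finite_finset.
split=> //; rewrite /cardset cardfE.
pose g (x : fset_set A) := f (val x).
apply: (@leq_card _ _ g) => x y /f_inj xy; apply/val_inj/xy.
  by rewrite -in_fset_set //; exact: (valP x).
by rewrite -in_fset_set //; exact: (valP y).
Qed.

Lemma leq_cardset (T : finType) (U : choiceType) (B : set U) (f : T -> U) :
  finite_set B -> injective f -> (forall t, B (f t)) -> (#|T| <= cardset B)%N.
Proof.
move=> finB f_inj fB; rewrite /cardset cardfE.
have fP t : f t \in fset_set B by rewrite in_fset_set // inE.
apply: (@leq_card _ _ (fun t => [` fP t]%fset)) => t t' /(congr1 val) /=.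
exact: f_inj.
Qed.

Lemma clonoids_finite p (J : finType) (q : J -> nat) :
  prime p -> (forall j, prime (q j)) -> (forall j, q j != p) ->
  finite_set [set C | linearly_closed_clonoid p q C].
Proof.
move=> p_pr q_pr q_neq.
pose U (C : set (fop (prodspace q) 'F_p)) :
    {set {ffun prodspace q 1 -> 'F_p}} :=
  [set f | `[< members C 0 f >]]%SET.
suff injU : {in [set C | linearly_closed_clonoid p q C]%classic &, injective U}.
  by case: (finite_set_inj injU).
have sub C C' :
   linearly_closed_clonoid p q C -> linearly_closed_clonoid p q C' ->
   U C = U C' -> (C `<=` C')%classic.
  move=> clC clC' /setP UCC' [n f] Cf.
  apply: (unary_part clC' p_pr q_pr q_neq) => u.
  have := UCC' (linear_subst f u); rewrite !inE => E.
  apply/asboolP; rewrite -E; apply/asboolP.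
  by case: clC => _ _; apply.
move=> C C'; rewrite !inE => clC clC' UE.
by apply/seteqP; split; apply: sub.
Qed.

(** * Taylor expansion of functions on a prime field *)

Section Derivative.
Variable p : nat.
Hypothesis p_pr : prime p.
Local Notation F := 'F_p.

Lemma Fp_expp (x : F) : x ^+ p = x.
Proof. by rewrite -[RHS]expf_card card_Fp. Qed.

Lemma Fp_exp_pred (x : F) : x ^+ p.-1 = (x != 0)%:R.
Proof.
have [->|x0] := eqVneq x 0.
  by rewrite expr0n -leqn0 leqNgt ltn_predRL prime_gt1.
by apply: (mulfI x0); rewrite -exprS prednK ?prime_gt0 // Fp_expp mulr1.
Qed.

(** For j = 0 the sum is p = 0. Otherwise X^j - 1 has too few roots, so some nonzero g has g^j
    different from 1; scaling by g permutes the terms but multiplies the sum by g^j. *)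
Lemma Fp_power_sum j : (j < p.-1)%N -> \sum_(a : F) a ^+ j = 0.
Proof.
case: j => [_|j jp].
  under eq_bigr do rewrite expr0.
  by rewrite sumr_const card_Fp // pchar_Fp_0.
have [g g0 gj] : exists2 g : F, g != 0 & g ^+ j.+1 != 1.
  apply/exists_inP; apply: contraLR jp => /exists_inPn gj.
  rewrite -leqNgt.
  have := @max_poly_roots F ('X^(j.+1) - 1) (enum [pred g : F | g != 0])
    _ _ (enum_uniq _).
  rewrite size_XnsubC // ltnS -cardE.
  have -> : #|[pred g : F | g != 0]| = (p.-1).
    by have := cardC1 (0 : F); rewrite card_Fp.
  apply; first by rewrite -size_poly_eq0 size_XnsubC.
  apply/allP => g; rewrite mem_enum inE => g0.
  by rewrite rootE !hornerE subr_eq0; move: (gj g g0); rewrite negbK.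
have /eqP : (g ^+ j.+1 - 1) * \sum_(a : F) a ^+ j.+1 = 0.
  rewrite mulrBl mul1r mulr_sumr; apply/eqP; rewrite subr_eq0; apply/eqP.
  rewrite [RHS](reindex_inj (mulfI g0)).
  by apply: eq_bigr => a _; rewrite exprMn.
by rewrite mulf_eq0 subr_eq0 (negPf gj) => /eqP.
Qed.

(* On a polynomial function of degree less than p this is the derivative, since
   the sum of a^j over F_p is -1 for j = p - 1 and 0 for the other j that
   occur. *)
Definition fderiv (phi : F -> F) (t : F) : F :=
  - \sum_(a : F) a ^+ p.-2 * phi (t + a).

(** The source of new linear factors: w times the derivative only takes values of phi at points
    linear in t and w. For nonzero w replace a by a w; for w = 0 the power sum with exponent p - 2
    vanishes. *)
Lemma fderiv_scale (phi : F -> F) t w :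
  w * fderiv phi t = - \sum_(a : F) a ^+ p.-2 * phi (t + a * w).
Proof.
rewrite /fderiv mulrN; congr (- _); have [->|w0] := eqVneq w 0.
  under [RHS]eq_bigr do rewrite mulr0 addr0.
  rewrite mul0r -mulr_suml Fp_power_sum ?mul0r //.
  by rewrite ltn_predL ltn_predRL prime_gt1.
have ww : w * w ^+ p.-2 = 1.
  by rewrite -exprS prednK ?ltn_predRL ?prime_gt1 // Fp_exp_pred w0.
rewrite (reindex_inj (mulIf w0)) mulr_sumr; apply: eq_bigr => a _.
by rewrite exprMn !mulrA [w * _]mulrC -[a ^+ _ * w * _]mulrA ww mulr1.
Qed.

Lemma fderiv_horner (P : {poly F}) t : (size P <= p)%N ->
  fderiv (horner P) t = P^`().[t].
Proof.
move=> szP; rewrite /fderiv.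
under eq_bigr do rewrite (nderiv_taylor_wide (mulrC _ _) szP) mulr_sumr.
rewrite exchange_big /=.
have p1 := prime_gt1 p_pr.
rewrite (bigD1 (Ordinal p1)) //= [X in _ + X]big1 ?addr0 => [|[e ep]].
  rewrite nderivn1; under eq_bigr do
    rewrite mulrCA -exprSr prednK ?ltn_predRL // Fp_exp_pred.
  rewrite -mulr_sumr -mulrN -[RHS]mulr1; congr (_ * _).
  (* The indicators of a != 0 sum to -1, because the a^0 sum to 0. *)
  have /Fp_power_sum/eqP : (0 < p.-1)%N by rewrite ltn_predRL.
  rewrite (bigD1 0) //= expr0 addr_eq0 => /eqP E; rewrite [RHS]E.
  rewrite (bigD1 0) //= add0r; congr (- _).
  by apply: eq_bigr => a; rewrite expr0 => ->.
move=> /= e1; under eq_bigr do rewrite mulrCA -exprD.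
rewrite -mulr_sumr; apply/eqP; rewrite mulf_eq0; apply/orP; right; apply/eqP.
(* The exponent is p - 2 for e = 0; for e > 1, a^p = a reduces it to e - 1 < p - 1. *)
case: e ep e1 => [|[|e]] //= ep _.
  by rewrite addn0 Fp_power_sum // ltn_predL ltn_predRL.
under eq_bigr => a _.
  have -> : (p.-2 + e.+2 = p + e)%N by lia.
  rewrite exprD Fp_expp -exprS; over.
by rewrite Fp_power_sum // -ltnS prednK // prime_gt0.
Qed.

Lemma Fp_interpolation (phi : F -> F) :
  exists2 P : {poly F}, (size P <= p)%N & phi = horner P.
Proof.
(* [L c] induces the indicator function of c. *)
pose L c : {poly F} := 1 - ('X - c%:P) ^+ p.-1.
exists (\sum_c phi c *: L c).
  apply: (leq_trans (size_sum _ _ _)); apply/bigmax_leqP => c _.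
  apply: (leq_trans (size_scale_leq _ _)).
  rewrite (leq_trans (size_polyD _ _)) // size_polyN size_exp_XsubC size_poly1.
  by rewrite geq_max prednK ?prime_gt0 ?leqnn.
apply/funext => x; rewrite horner_sum (bigD1 x) //= big1 => [|c cx].
  by rewrite !hornerE subrr Fp_exp_pred eqxx /= subr0 mulr1.
rewrite !hornerE Fp_exp_pred subr_eq0 eq_sym cx /=.
by rewrite subrr mulr0.
Qed.

Lemma fderiv_taylor (phi : F -> F) x :
  phi x = \sum_(h < p) x ^+ h * ((h`!)%:R^-1 * iter h fderiv phi 0).
Proof.
have [P szP ->] := Fp_interpolation phi.
have iterE h : iter h fderiv (horner P) = horner P^`(h).
  elim: h => [|h IH] //=; rewrite IH; apply/funext => t.
  rewrite fderiv_horner ?derivnS //; apply: leq_trans szP.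
  elim: h {IH} => [|h IH] //; rewrite derivnS.
  exact: leq_trans (leq_trans (size_poly _ _) (leq_pred _)) IH.
rewrite -[x in LHS]add0r (nderiv_taylor_wide (mulrC _ _) szP).
apply: eq_bigr => h _; rewrite mulrC iterE nderivn_def hornerMn.
rewrite -[_.[_] *+ _]mulr_natl.
(* As h < p, the prime p divides no factor of h!, which is therefore invertible. *)
rewrite mulKf // -(dvdn_pcharf (pchar_Fp p_pr)) fact_prod Euclid_dvd_prod //.
rewrite big1_seq // => k.
rewrite mem_index_iota => /andP[_ /andP[k0 kh]]; apply/negbTE.
by rewrite gtnNdvd // (leq_ltn_trans _ (ltn_ord h)).
Qed.
End Derivative.

(** * Functions in a clone *)

Section Preservation.
Variables (A : finType) (C : set (fop (power A) A)).

(* For a clone C and a finite nonempty I this says that F belongs to C; the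
   freedom in I makes changes of variables painless. *)
Definition preserves (I : Type) (F : (I -> A) -> A) : Prop :=
  forall n (G : I -> {ffun power A n.+1 -> A}), (forall i, members C n (G i)) ->
  members C n [ffun x => F (fun i => G i x)].

Lemma preserves_ext I (F G : (I -> A) -> A) :
  preserves F -> F =1 G -> preserves G.
Proof. by move=> CF /funext <-. Qed.

Lemma preserves_var I (i : I) : preserves (fun v => v i).
Proof.
move=> n G CG; have := CG i; congr (members C n _).
by apply/ffunP => x; rewrite ffunE.
Qed.

Lemma preserves_comp I J (F : (I -> A) -> A) (H : I -> (J -> A) -> A) :
  preserves F -> (forall i, preserves (H i)) ->
  preserves (fun v => F (fun i => H i v)).
Proof.
move=> CF CH n G CG; have := CF n _ (fun i => CH i n G CG).
congr (members C n _); apply/ffunP => x; rewrite !ffunE; congr F.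
by apply/funext => i; rewrite ffunE.
Qed.

Lemma preserves_members n (f : {ffun power A n.+1 -> A}) : clone C ->
  members C n f <-> preserves (fun v : 'I_n.+1 -> A => f (finfun v)).
Proof.
case=> proj comp; split=> [Cf k G CG|/(_ n (@projection A n.+1) (proj n))].
  exact: comp n k f G Cf CG.
congr (members C n _); apply/ffunP => x; rewrite ffunE; congr (f _).
by apply/ffunP => i; rewrite !ffunE.
Qed.
End Preservation.

(** * Clones containing the addition *)

Section AboveAddition.
Variables (s : nat) (C : set (fop (power 'Z_s) 'Z_s)).
Hypothesis C_add : clones_above_addition s C.

Lemma above_clone : clone C. Proof. by case: C_add. Qed.

Lemma preservesD I (F G : (I -> 'Z_s) -> 'Z_s) :
  preserves C F -> preserves C G -> preserves C (fun v => F v + G v).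
Proof.
move=> CF CG.
have Cadd : C (addop 'Z_s) by apply: C_add.2 => D [_ GD]; exact: GD.
have {}Cadd : members C 1 (projT2 (addop 'Z_s)) by [].
have /(preserves_members _ above_clone) {}Cadd := Cadd.
have CFG (i : 'I_2) : preserves C (if i == 0 then F else G) by case: ifP.
have := preserves_comp Cadd CFG; congr (preserves C _).
by apply/funext => v; rewrite /= !ffunE.
Qed.

(** I may be empty, so 0 is written as a multiple of a projection of the target arity, the factor
    being the modulus of ['Z_s]. *)
Lemma preserves0 I : preserves C (fun _ : I -> 'Z_s => 0).
Proof.
move=> n G _.
have /(preserves_members _ above_clone) C1 := above_clone.1 n ord0.
have Ck k : preserves C (fun v => v ord0 *+ k.+1).
  elim: k => [|k IH]; first exact: preserves_var.
  exact: (preservesD (preserves_var ord0) IH).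
have := Ck n (Zp_trunc s).+1 n (@projection _ _) (above_clone.1 n).
congr (members C n _); apply/ffunP => x; rewrite !ffunE.
by apply/val_inj; rewrite Zp_mulrn /= modnMl.
Qed.

Lemma preserves_sum I K (r : seq K) (P : pred K)
    (F : K -> (I -> 'Z_s) -> 'Z_s) :
  (forall k, P k -> preserves C (F k)) ->
  preserves C (fun v => \sum_(k <- r | P k) F k v).
Proof.
move=> CF; elim: r => [|k r IH].
  by apply: (preserves_ext (@preserves0 I)) => v; rewrite big_nil.
case Pk: (P k); last by apply: (preserves_ext IH) => v; rewrite big_cons Pk.
by apply: (preserves_ext (preservesD (CF k Pk) IH)) => v; rewrite big_cons Pk.
Qed.

Lemma preservesZ I c (F : (I -> 'Z_s) -> 'Z_s) :
  preserves C F -> preserves C (fun v => c * F v).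
Proof.
move=> CF; rewrite -(natr_Zp c); elim: (c : nat) => [|k IH].
  by apply: (preserves_ext (@preserves0 I)) => v; rewrite mul0r.
by apply: (preserves_ext (preservesD CF IH)) => v; rewrite mulrS mulrDl mul1r.
Qed.
End AboveAddition.

(** * Functions on squarefree cyclic groups *)

Section Squarefree.
Variables (m : nat) (p : 'I_m -> nat) (s : nat).
Hypothesis m_gt0 : (0 < m)%N.
Hypothesis p_prime : forall i, prime (p i).
Hypothesis p_distinct : injective p.
Hypothesis s_def : s = (\prod_(i < m) p i)%N.

Definition residue (i : 'I_m) (x : 'Z_s) : 'F_(p i) := (x : nat)%:R.

(** The Chinese remainder lift of a with all other residues 0: N vanishes modulo the other primes,
    and dividing by N modulo [p i] corrects the remaining residue. *)
Definition embed (i : 'I_m) (a : 'F_(p i)) : 'Z_s :=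
  let N := (\prod_(j < m | j != i) p j)%N in
  (N * (a / N%:R : 'F_(p i))%R)%:R.

Lemma dvdn_s i : (p i %| s)%N.
Proof. by rewrite s_def (bigD1 i) //= dvdn_mulr. Qed.

Lemma s_gt1 : (1 < s)%N.
Proof.
apply: leq_trans (prime_gt1 (p_prime (Ordinal m_gt0))) _.
apply: dvdn_leq; last exact: dvdn_s.
by rewrite s_def prodn_cond_gt0 // => i _; apply: prime_gt0.
Qed.

Lemma residue_nat i k : residue i k%:R = k%:R.
Proof.
rewrite /residue val_Zp_nat ?s_gt1 // -(Fp_nat_mod (p_prime i)).
by rewrite modn_dvdm ?dvdn_s // Fp_nat_mod.
Qed.

Lemma residue0 i : residue i 0 = 0. Proof. exact: (residue_nat i 0). Qed.

Lemma residueD i x y : residue i (x + y) = residue i x + residue i y.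
Proof. by rewrite -(natr_Zp x) -(natr_Zp y) -natrD !residue_nat natrD. Qed.

Lemma residueM i x y : residue i (x * y) = residue i x * residue i y.
Proof. by rewrite -(natr_Zp x) -(natr_Zp y) -natrM !residue_nat natrM. Qed.

Definition residue_sum i := big_morph (residue i) (residueD i) (residue0 i).

Lemma dvdn_prod_distinct (r : seq 'I_m) k :
  uniq r -> (forall i, p i %| k)%N -> (\prod_(i <- r) p i %| k)%N.
Proof.
move=> + pk; elim: r => [|i r IH] /=; first by rewrite big_nil dvd1n.
case/andP => ir /IH rk; rewrite big_cons Gauss_dvd ?pk //.
rewrite prime_coprime // Euclid_dvd_prod // big_has.
apply: contra ir => /hasP[j jr]; rewrite dvdn_prime2 // => /eqP /p_distinct.
by move->.
Qed.

Lemma residue_inj x y : (forall i, residue i x = residue i y) -> x = y.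
Proof.
move=> xy; apply/val_inj/eqP => /=.
have lt (z : 'Z_s) : (z < s)%N by rewrite -[X in (_ < X)%N](Zp_cast s_gt1).
rewrite -(modn_small (lt x)) -(modn_small (lt y)).
wlog yx : x y xy / (y <= x)%N.
  move=> W; have /orP[xy'|] := leq_total x y; last exact: W.
  by rewrite eq_sym; apply: W xy'.
rewrite eqn_mod_dvd // [X in (X %| _)%N]s_def; apply: dvdn_prod_distinct.
  exact: index_enum_uniq.
move=> i; rewrite -eqn_mod_dvd // -!(val_Fp_nat (p_prime i)).
by have := xy i; rewrite /residue => ->.
Qed.

Lemma residue_embed i a : residue i (embed a) = a.
Proof.
rewrite /embed residue_nat natrM natr_Zp mulrCA mulfV ?mulr1 //.
rewrite -(dvdn_pcharf (pchar_Fp (p_prime i))) Euclid_dvd_prod //.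
rewrite big1 // => j; rewrite dvdn_prime2 //; apply: contra_neqF => /eqP.
by move/p_distinct.
Qed.

Lemma residue_embed_neq i j (a : 'F_(p i)) : j != i -> residue j (embed a) = 0.
Proof.
move=> ji; rewrite /embed residue_nat (bigD1 j) //= !natrM.
by rewrite -[(p j)%:R]Fp_nat_mod ?modnn ?mul0r.
Qed.

Lemma embedD i (a b : 'F_(p i)) : embed (a + b) = embed a + embed b.
Proof.
apply: residue_inj => j; rewrite residueD.
have [<-|ji] := eqVneq i j; first by rewrite !residue_embed.
by rewrite !residue_embed_neq ?addr0 // eq_sym.
Qed.

Lemma embedZ i x (a : 'F_(p i)) : embed (residue i x * a) = x * embed a.
Proof.
apply: residue_inj => j; rewrite residueM.
have [<-|ji] := eqVneq i j; first by rewrite !residue_embed.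
by rewrite !residue_embed_neq ?mulr0 // eq_sym.
Qed.

Lemma embed0 i : embed (0 : 'F_(p i)) = 0.
Proof. by have := embedZ 0 (0 : 'F_(p i)); rewrite mulr0 mul0r. Qed.

Definition embed_sum i :=
  big_morph (@embed i) (@embedD i) (@embed0 i).

Lemma sum_embed_residue x : \sum_i embed (residue i x) = x.
Proof.
apply: residue_inj => j; rewrite residue_sum (bigD1 j) //= residue_embed.
by rewrite big1 ?addr0 // => i ij; rewrite residue_embed_neq // eq_sym.
Qed.

(** * Separating one prime from the others *)

Definition other_primes (i : 'I_m) : {j : 'I_m | j != i} -> nat :=
  fun j => p (val j).
Arguments other_primes : clear implicits.
Local Notation opset i := (set (fop (prodspace (other_primes i)) 'F_(p i))).
Local Notation K i n := (prodspace (other_primes i) n).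

Definition to_space i n (v : 'I_n -> 'Z_s) : K i n :=
  [ffun j => \col_k residue (val j) (v k)].

Definition of_space i n (u : K i n) (k : 'I_n) : 'Z_s :=
  \sum_(j : {j : 'I_m | j != i}) embed (u j k 0 : 'F_(p (val j))).

Lemma residue_of_space i n (u : K i n) k : residue i (of_space u k) = 0.
Proof.
rewrite residue_sum big1 // => j _.
by rewrite residue_embed_neq // eq_sym (valP j).
Qed.

Lemma residue_of_space_neq i n (u : K i n) k (j : {j : 'I_m | j != i}) :
  residue (val j) (of_space u k) = u j k 0.
Proof.
rewrite residue_sum (bigD1 j) //= residue_embed big1 ?addr0 // => j' j'j.
by rewrite residue_embed_neq // eq_sym.
Qed.

Lemma of_spaceK i n (u : K i n) : to_space i (of_space u) = u.
Proof.
apply/ffunP => j; apply/matrixP => k l; rewrite ffunE mxE ord1.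
exact: residue_of_space_neq.
Qed.

Lemma to_spaceK i n (v : 'I_n -> 'Z_s) k :
  embed (residue i (v k)) + of_space (to_space i v) k = v k.
Proof.
apply: residue_inj => j; rewrite residueD; have [->|ji] := eqVneq j i.
  by rewrite residue_embed residue_of_space addr0.
rewrite residue_embed_neq // add0r.
have /= -> := residue_of_space_neq (to_space i v) k (exist _ j ji).
by rewrite ffunE mxE.
Qed.

Lemma to_space_linear i n l (c : 'I_n -> 'I_l -> 'Z_s) (v : 'I_l -> 'Z_s) :
  to_space i (fun k => \sum_r c k r * v r) =
  [ffun j => (\matrix_(k, r) residue (val j) (c k r)) *m to_space i v j].
Proof.
apply/ffunP => j; apply/matrixP => k l'; rewrite !ffunE !mxE residue_sum.
by apply: eq_bigr => r _; rewrite residueM !mxE.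
Qed.

Lemma embedM i (a b : 'F_(p i)) : embed (a * b) = embed a * embed b.
Proof. by rewrite -embedZ residue_embed. Qed.

(** * Functions with d linear factors *)

Section Level.
Variables (C : set (fop (power 'Z_s) 'Z_s)) (i : 'I_m).
Hypothesis C_add : clones_above_addition s C.
Local Notation F := 'F_(p i).
Implicit Types d e : nat.

(* The three summands of the index type number the variables z, x and y; only
   the residues modulo p i of the z and x and the other residues of the y are
   used. *)
Definition level n d (g : (nat -> F) -> K i n -> F) : Prop :=
  preserves C (fun v : nat + nat + 'I_n -> 'Z_s =>
    embed (\prod_(k < d) residue i (v (inl (inl (val k)))) *
      g (fun k => residue i (v (inl (inr k))))
        (to_space i (fun k => v (inr k))))).

Lemma level_subst n d g I (Z X : nat -> (I -> 'Z_s) -> 'Z_s)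
    (Y : 'I_n -> (I -> 'Z_s) -> 'Z_s) : level d g ->
  (forall k, preserves C (Z k)) -> (forall k, preserves C (X k)) ->
  (forall k, preserves C (Y k)) ->
  preserves C (fun v => embed (\prod_(k < d) residue i (Z k v) *
    g (fun k => residue i (X k v)) (to_space i (fun k => Y k v)))).
Proof.
move=> Cg CZ CX CY.
apply: (preserves_comp (H := fun a => match a with
  inl (inl k) => Z k | inl (inr k) => X k | inr k => Y k end) Cg).
by case=> [[]|].
Qed.

Lemma level_sum n d I (r : seq I) (P : pred I)
    (g : I -> (nat -> F) -> K i n -> F) :
  (forall a, P a -> level d (g a)) ->
  level d (fun x u => \sum_(a <- r | P a) g a x u).
Proof.
move=> Cg; apply: (preserves_ext (preserves_sum C_add r Cg)) => v.
by rewrite mulr_sumr embed_sum.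
Qed.

Lemma levelZ n d c (g : (nat -> F) -> K i n -> F) : level d g ->
  level d (fun x u => c * g x u).
Proof.
move=> Cg; apply: (preserves_ext (preservesZ C_add (embed c) Cg)) => v.
by rewrite -embedM mulrCA.
Qed.

Definition update (x : nat -> F) n (t : F) : nat -> F :=
  fun k => if k == n then t else x k.

(** z_d is the first z-variable outside the product, hence free as a direction of differentiation: c
    = (1, a) shifts x_r along it, and c = (0, 0) sets x_r to 0. *)
Lemma level_substx n d r c (g : (nat -> F) -> K i n -> F) : level d g ->
  preserves C (fun v : nat + nat + 'I_n -> 'Z_s =>
    embed (\prod_(k < d) residue i (v (inl (inl (val k)))) *
      g (update (fun k => residue i (v (inl (inr k)))) r
           (c.1 * residue i (v (inl (inr r))) +
            c.2 * residue i (v (inl (inl d)))))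
        (to_space i (fun k => v (inr k))))).
Proof.
move=> Cg.
pose X k (v : nat + nat + 'I_n -> 'Z_s) := if k == r
  then embed c.1 * v (inl (inr r)) + embed c.2 * v (inl (inl d))
  else v (inl (inr k)).
apply: (preserves_ext (level_subst (Z := fun k v => v (inl (inl k))) (X := X)
  (Y := fun k v => v (inr k)) Cg _ _ _)) => [k|k|k|v].
- exact: preserves_var.
- rewrite /X; case: (k == r); last exact: preserves_var.
  exact: (preservesD C_add (preservesZ C_add _ (preserves_var _))
    (preservesZ C_add _ (preserves_var _))).
- exact: preserves_var.
congr (embed (_ * g _ _)); apply/funext => k; rewrite /X /update.
by case: ifP => // _; rewrite residueD !residueM !residue_embed.
Qed.

Definition xderiv n r (g : (nat -> F) -> K i n -> F) :=
  fun x u => fderiv (fun t => g (update x r t) u) (x r).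

(** By [fderiv_scale] with w = z_d, a combination of shifts along z_d is the derivative times the
    new factor z_d. *)
Lemma level_xderiv n d r (g : (nat -> F) -> K i n -> F) :
  level d g -> level d.+1 (xderiv r g).
Proof.
move=> Cg.
have := preservesZ C_add (embed (-1 : F)) (preserves_sum C_add (index_enum F)
  (fun a (_ : predT a) => preservesZ C_add (embed (a ^+ (p i).-2))
    (level_substx r (1, a) Cg))).
move=> CS; apply: (preserves_ext CS) => v.
rewrite [in RHS]big_ord_recr /= -mulrA fderiv_scale //.
under eq_bigr do rewrite -embedM.
rewrite -embed_sum -embedM mulN1r mulrN; congr (embed (- _)).
rewrite mulr_sumr; apply: eq_bigr => a _.
by rewrite mulrCA mul1r.
Qed.

Lemma iter_xderiv n r (g : (nat -> F) -> K i n -> F) h x u :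
  iter h (xderiv r) g x u =
  iter h (@fderiv (p i)) (fun t => g (update x r t) u) (x r).
Proof.
have updK y : update y r (y r) = y.
  by apply/funext => k; rewrite /update; case: eqP => // ->.
elim: h x => [|h IH] x /=; first by rewrite updK.
congr (fderiv _ _); apply/funext => t; rewrite IH /update eqxx.
congr (iter _ _ _ _); apply/funext => t'; congr (g _ _).
by apply/funext => k; case: (k == r).
Qed.

Lemma level_taylor n d r h (g : (nat -> F) -> K i n -> F) : level d g ->
  level (d + h) (fun x u =>
    iter h (@fderiv (p i)) (fun t => g (update x r t) u) 0).
Proof.
move=> Cg.
have {}Cg : level (d + h) (iter h (xderiv r) g).
  elim: h => [|h IH]; first by rewrite addn0.
  by rewrite addnS; apply: level_xderiv.
apply: (preserves_ext (level_substx r (0, 0) Cg)) => v.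
congr (embed (_ * _)); rewrite iter_xderiv !mul0r addr0.
rewrite [update _ _ _ r]/update eqxx; congr (iter _ _ _ _).
apply/funext => t'; congr (g _ _).
by apply/funext => k; rewrite /update; case: (k == r).
Qed.

(** The last h linear factors are specialized to x_r. *)
Lemma level_mulx n d r h (g : (nat -> F) -> K i n -> F) : level (d + h) g ->
  level d (fun x u => x r ^+ h * g x u).
Proof.
move=> Cg.
apply: (preserves_ext (level_subst
  (Z := fun k v => if (k < d)%N then v (inl (inl k)) else v (inl (inr r)))
  (X := fun k v => v (inl (inr k))) (Y := fun k v => v (inr k)) Cg _ _ _))
  => [k|k|k|v].
- by case: (k < _)%N; apply: preserves_var.
- exact: preserves_var.
- exact: preserves_var.
congr embed; rewrite mulrA; congr (_ * _); rewrite big_split_ord /=.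
congr (_ * _); first by apply: eq_bigr => k _; rewrite ltn_ord.
under eq_bigr do rewrite ltnNge leq_addr /=.
by rewrite prodr_const card_ord.
Qed.

(* z^p = z absorbs p - 1 of the linear factors, as soon as one is left. *)
Lemma level_drop n d (g : (nat -> F) -> K i n -> F) :
  level (d.+1 + (p i).-1) g -> level d.+1 g.
Proof.
move=> Cg.
apply: (preserves_ext (level_subst
  (Z := fun k v => if (k < d.+1)%N then v (inl (inl k)) else v (inl (inl 0%N)))
  (X := fun k v => v (inl (inr k))) (Y := fun k v => v (inr k)) Cg _ _ _))
  => [k|k|k|v].
- by case: (k < _)%N; apply: preserves_var.
- exact: preserves_var.
- exact: preserves_var.
congr (embed (_ * _)); rewrite big_split_ord /=.
under eq_bigr do rewrite ltn_ord.
under [X in _ * X]eq_bigr do rewrite ltnNge leq_addr /=.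
rewrite prodr_const card_ord !big_ord_recl /= mulrAC -exprS.
by rewrite prednK ?prime_gt0 // Fp_expp.
Qed.

(** The last linear factor of g is replaced by the function W made from g', whose own factors are
    renumbered from d on to avoid the d remaining ones. *)
Lemma level_mul n d e (g g' : (nat -> F) -> K i n -> F) :
  level d.+1 g -> level e g' -> level (d + e) (fun x u => g x u * g' x u).
Proof.
move=> Cg Cg'.
pose W (v : nat + nat + 'I_n -> 'Z_s) :=
  embed (\prod_(k < e) residue i (v (inl (inl (d + k)%N))) *
    g' (fun k => residue i (v (inl (inr k))))
      (to_space i (fun k => v (inr k)))).
have CW : preserves C W.
  by apply: (level_subst (Z := fun k v => v (inl (inl (d + k)%N)))
    (X := fun k v => v (inl (inr k))) (Y := fun k v => v (inr k)) Cg') => k;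
    apply: preserves_var.
apply: (preserves_ext (level_subst
  (Z := fun k v => if (k < d)%N then v (inl (inl k)) else W v)
  (X := fun k v => v (inl (inr k))) (Y := fun k v => v (inr k)) Cg _ _ _))
  => [k|k|k|v].
- by case: (k < d)%N => //; apply: preserves_var.
- exact: preserves_var.
- exact: preserves_var.
congr embed; rewrite big_ord_recr /= ltnn residue_embed big_split_ord /=.
under eq_bigr do rewrite ltn_ord.
by rewrite -!mulrA; congr (_ * (_ * _)); rewrite mulrC.
Qed.

(* Substituting the function into one of its own linear factors p - 1 times
   turns g into g^p = g and adds (p - 1)(d + 1) linear factors; level_drop then
   removes all but p - 1 of these. *)
Lemma level_lift n d (g : (nat -> F) -> K i n -> F) :
  level d.+2 g -> level (d.+2 + (p i).-1) g.
Proof.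
move=> Cg.
have Ck k : level (d.+1 * k + d.+2) (fun x u => g x u ^+ k.+1).
  elim: k => [|k IH].
    by rewrite muln0; apply: (preserves_ext Cg) => v; rewrite expr1.
  rewrite mulnS -addnA.
  exact: (level_mul Cg IH).
have {}Ck : level (d.+1 * (p i).-1 + d.+2) g.
  apply: (preserves_ext (Ck (p i).-1)) => v.
  by rewrite prednK ?prime_gt0 // Fp_expp.
have drop e : level (d.+1 + (p i).-1 * e.+1).+1 g -> level (d.+2 + (p i).-1) g.
  elim: e => [|e IH]; first by rewrite muln1.
  by rewrite mulnS addnCA -addnS addnC => /level_drop /IH.
by apply: (drop d); move: Ck; rewrite mulnC addnC.
Qed.

Lemma level0_members n (f : {ffun power 'Z_s n.+1 -> 'Z_s}) : members C n f ->
  level 0 (fun x u => residue i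
    (f [ffun k : 'I_n.+1 => embed (x k : F) + of_space u k])).
Proof.
move=> /(preserves_members _ (above_clone C_add)) Cf.
(* [embed 1] is the idempotent with residue 1 at i and 0 elsewhere, so H joins the i-th residue of
   x_k to the other residues of y_k. *)
pose H (k : 'I_n.+1) (v : nat + nat + 'I_n.+1 -> 'Z_s) :=
  embed (1 : F) * v (inl (inr (val k))) + (1 - embed (1 : F)) * v (inr k).
have CH k : preserves C (H k).
  exact: (preservesD C_add (preservesZ C_add _ (preserves_var _))
    (preservesZ C_add _ (preserves_var _))).
have CfH := preservesZ C_add (embed (1 : F)) (preserves_comp Cf CH).
apply: (preserves_ext CfH) => v.
rewrite big_ord0 mul1r mulrC -embedZ mulr1; congr (embed (residue i (f _))).
apply/ffunP => k; rewrite !ffunE /H mulrBl mul1r.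
rewrite ![embed 1 * _]mulrC -!embedZ !mulr1.
congr (_ + _); apply/eqP; rewrite subr_eq addrC eq_sym; apply/eqP.
exact: (to_spaceK i (fun k => v (inr k))).
Qed.
End Level.

(** * Recovering a clone from its low levels *)

Section Determined.
Variables (C C' : set (fop (power 'Z_s) 'Z_s)) (i : 'I_m).
Hypothesis C_add : clones_above_addition s C.
Hypothesis C'_add : clones_above_addition s C'.
Local Notation F := 'F_(p i).

(** For d > p_i, [level_drop] descends in C to d - (p_i - 1), which is at least 2, and [level_lift]
    climbs back in C'. *)
Lemma level_bounded n d (g : (nat -> F) -> K i n -> F) :
  (forall e, (e <= p i)%N -> level C e g -> level C' e g) ->
  level C d g -> level C' d g.
Proof.
move=> CC'; have [k] := ubnP d; elim: k d => // k IH d dk Cg.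
have [dp|pd] := leqP d (p i); first exact: CC'.
have p1 := prime_gt1 (p_prime i).
have dE : d = ((d - (p i).+1).+2 + (p i).-1)%N.
  by lia.
rewrite dE; apply: level_lift; apply: IH; last first.
  by apply: level_drop; rewrite -dE.
by lia.
Qed.

(* Induction on the number of x-variables on which g depends, by Taylor
   expansion at 0 in the last of them. *)
Lemma level_expand n :
  (forall d (f : K i n -> F), level C d (fun=> f) -> level C' d (fun=> f)) ->
  forall N d (g : (nat -> F) -> K i n -> F),
  (forall x y, (forall k, (k < N)%N -> x k = y k) -> g x = g y) ->
  level C d g -> level C' d g.
Proof.
move=> CC'; elim=> [|N IH] d g gN Cg.
  have gE : g = fun=> g (fun=> 0) by apply/funext => x; apply: gN.
  by rewrite gE; apply: CC'; rewrite -gE.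
have -> : g = fun x u => \sum_(h < p i) (h`!)%:R^-1 * (x N ^+ h *
    iter h (@fderiv (p i)) (fun t => g (update x N t) u) 0).
  apply/funext => x; apply/funext => u.
  have := fderiv_taylor (p_prime i) (fun t => g (update x N t) u) (x N).
  have -> : update x N (x N) = x.
    by apply/funext => k; rewrite /update; case: eqP => // ->.
  by move=> ->; apply: eq_bigr => h _; rewrite mulrCA.
apply: (level_sum C'_add) => h _; apply: (levelZ C'_add).
apply: level_mulx; apply: IH; last exact: level_taylor.
move=> x y xy; apply/funext => u; congr (iter _ _ _ _).
apply/funext => t; rewrite (gN _ (update y N t)) // => k kN.
rewrite /update; case: eqP => // /eqP kN'; apply: xy.
by rewrite ltn_neqAle kN'.
Qed.

Lemma clone_sub :
  (forall n d (f : K i n.+1 -> F), (d <= p i)%N ->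
     level C d (fun=> f) -> level C' d (fun=> f)) ->
  forall n (f : {ffun power 'Z_s n.+1 -> 'Z_s}), members C n f ->
  preserves C' (fun v : 'I_n.+1 -> 'Z_s => embed (residue i (f (finfun v)))).
Proof.
move=> CC' n f Cf.
have /level_expand L : forall d (f : K i n.+1 -> F),
    level C d (fun=> f) -> level C' d (fun=> f).
  by move=> d g; apply: level_bounded => e ep; apply: CC'.
have {}Cf := L n.+1 0 _ _ (level0_members i C_add Cf).
(* Both x_k and y_k become the k-th argument; the choice for z is a dummy, as there are no linear
   factors. *)
apply: (preserves_ext (level_subst
  (Z := fun _ v => v 0) (X := fun k v => v (inord k))
  (Y := fun k v => v k) (Cf _) _ _ _)) => [x y xy|k|k|k|v].
- apply/funext => u; congr (residue i (f _)); apply/ffunP => k.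
  by rewrite !ffunE xy.
- exact: preserves_var.
- exact: preserves_var.
- exact: preserves_var.
rewrite big_ord0 mul1r; congr (embed (residue i (f _))); apply/ffunP => k.
by rewrite !ffunE inord_val; apply: to_spaceK.
Qed.
End Determined.

Definition value (D : nat -> finType) (B : finType) (f : fop D B) :
  {ffun D (projT1 f).+1 -> B} := projT2 f.

(** * The clonoids attached to a clone *)

Section LevelClonoid.
Variables (C : set (fop (power 'Z_s) 'Z_s)) (i : 'I_m).
Hypothesis C_add : clones_above_addition s C.

Definition level_clonoid d : opset i :=

  [set f | level C d (fun=> value f)]%classic.

(** Lets one matrix over ['Z_s] realize independently chosen matrices over the different fields. *)
Lemma residues_surj (a : forall j : {j : 'I_m | j != i}, 'F_(p (val j))) :
  exists c : 'Z_s, forall j, residue (val j) c = a j.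
Proof.
pose u : K i 1 := [ffun j => const_mx (a j)].
exists (of_space u 0) => j.
by rewrite residue_of_space_neq ffunE mxE.
Qed.

Lemma level_clonoidP d : clonoids_at p i (level_clonoid d).
Proof.
split.
- exists (existT _ 0%N [ffun=> 0]).
  apply: (preserves_ext (preserves0 C_add (I := nat + nat + 'I_1))) => v.
  by rewrite /= ffunE mulr0 embed0.
- move=> n f g a b Cf Cg.
  have CD := preservesD C_add
    (preservesZ C_add (embed a) Cf) (preservesZ C_add (embed b) Cg).
  apply: (preserves_ext CD) => v /=.
  rewrite ffunE -!embedM -embedD mulrDr.
  by congr (embed (_ + _)); rewrite mulrCA.
move=> l n f A Cf.
have /fin_all_exists[c cE] : forall k : 'I_n.+1, exists c : 'I_l.+1 -> 'Z_s,
    forall r (j : {j : 'I_m | j != i}), residue (val j) (c r) = A j k r.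
  move=> k; apply: (@fin_all_exists _ _ (fun r x =>
    forall j : {j : 'I_m | j != i}, residue (val j) x = A j k r)) => r.
  exact: residues_surj.
apply: (preserves_ext (level_subst
  (Z := fun k v => v (inl (inl k)))
  (X := fun k v => v (inl (inr k)))
  (Y := fun k v => \sum_r c k r * v (inr r)) Cf _ _ _)) => [k|k|k|v].
- exact: preserves_var.
- exact: preserves_var.
- apply: (preserves_sum C_add) => r _.
  exact: (preservesZ C_add _ (preserves_var _)).
congr (embed (_ * _)); rewrite /= ffunE; congr (f _).
rewrite (to_space_linear i (fun k r => c k r) (fun r => v (inr r))).
apply/ffunP => j; rewrite !ffunE; congr (_ *m _).
by apply/matrixP => k r; rewrite mxE cE.
Qed.
End LevelClonoid.
Arguments level_clonoid : clear implicits.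

Lemma clone_determined C C' :
  clones_above_addition s C -> clones_above_addition s C' ->
  (forall i d, (d <= p i)%N -> level_clonoid C i d = level_clonoid C' i d) ->
  (C `<=` C')%classic.
Proof.
move=> C_add C'_add CC' [n f] Cf.
apply/(preserves_members _ (above_clone C'_add)).
apply: (preserves_ext (preserves_sum C'_add (index_enum 'I_m) (P := predT)
  (F := fun i v => embed (residue i (f (finfun v)))) _)) => [i _|v].
  apply: (clone_sub C_add C'_add) => // k d g dp.
  have gE : (finfun g : {ffun K i k.+1 -> 'F_(p i)}) = g :> (_ -> _).
    by apply/funext => u; rewrite ffunE.
  have : level C d (fun=> finfun g) = level C' d (fun=> finfun g).
    exact: (congr1 (fun D => members D k (finfun g)) (CC' i d dp)).
  by rewrite gE => ->.
exact: sum_embed_residue.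
Qed.

(** * Clones built from clonoids *)

Section Lift.
Variable i : 'I_m.
Local Notation F := 'F_(p i).
Implicit Types M : set (fop (prodspace (other_primes i)) F).

(* The clone generated by the addition and the x |-> embed (g (to_space i x))
   with g in M. *)
Definition clonoid_clone M : set (fop (power 'Z_s) 'Z_s) :=
  [set f | exists a : 'I_(projT1 f).+1 -> 'Z_s,
    exists2 g, members M (projT1 f) g &
    forall x : power 'Z_s (projT1 f).+1,
      value f x = \sum_k a k * x k + embed (g (to_space i x))]%classic.

(** Values of [embed] vanish modulo the other primes, so the outer g sees only the linear parts of
    the inner functions, while the outer linear part combines their M-parts linearly. *)
Lemma clonoid_clone_closed M : clonoids_at p i M -> clone (clonoid_clone M).
Proof.
move=> clM; split=> [n r|n l f h].
  exists (fun k => (k == r)%:R), [ffun=> 0]; first exact: (clonoid0 clM).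
  move=> x; rewrite !ffunE embed0 addr0 (bigD1 r) //= eqxx mul1r big1 ?addr0 //.
  by move=> k /negPf ->; rewrite mul0r.
case=> a [g Mg fE] Lh.
have /fin_all_exists[b /fin_all_exists[e he]] : forall k,
    exists b : 'I_l.+1 -> 'Z_s, exists e, members M l e /\
      forall x, h k x = \sum_r b r * x r + embed (e (to_space i x)).
  by move=> k; have [b [e Me eE]] := Lh k; exists b, e.
exists (fun r => \sum_k a k * b k r).
exists [ffun u => [ffun u => \sum_k residue i (a k) * e k u] u +
  linear_subst g (fun j => \matrix_(k, r) residue (val j) (b k r)) u].
  apply: (clonoidD clM); last by case: clM => _ _; apply.
  by apply: (clonoid_sum clM) => k _; case: (he k).
move=> x; rewrite /value /= !ffunE fE /= embedD addrA; congr (_ + embed (g _)).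
  rewrite embed_sum; under eq_bigr => k _.
    rewrite ffunE (he k).2 mulrDr mulr_sumr -embedZ; over.
  rewrite big_split exchange_big /=; congr (_ + _).
  apply: eq_bigr => r _; rewrite mulr_suml.
  by apply: eq_bigr => k _; rewrite mulrA.
rewrite -(to_space_linear i b x); apply/ffunP => j; apply/matrixP => k r.
rewrite !ffunE !mxE !ffunE (he k).2 residueD residue_embed_neq ?addr0 //.
exact: (valP j).
Qed.

Lemma clonoid_clone_above M : clonoids_at p i M ->
  clones_above_addition s (clonoid_clone M).
Proof.
move=> clM; split; first exact: clonoid_clone_closed.
move=> f; apply; split; first exact: clonoid_clone_closed.
move=> _ ->; exists (fun=> 1), [ffun=> 0]; first exact: (clonoid0 clM).
by move=> x; rewrite /value /= !ffunE embed0 addr0 big_ord_recl big_ord1 !mul1r;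
  congr (x _ + x _); apply/val_inj.
Qed.
End Lift.

Definition zero_clonoid i : opset i :=
  [set f : fop (prodspace (other_primes i)) 'F_(p i) |
    forall u, value f u = 0]%classic.

Arguments zero_clonoid : clear implicits.

Lemma zero_clonoidP i : clonoids_at p i (zero_clonoid i).
Proof.
split.
- by exists (existT _ 0%N [ffun=> 0]) => u; rewrite ffunE.
- by move=> n f g a b f0 g0 u; rewrite /= ffunE f0 g0 !mulr0 addr0.
- by move=> l n f A f0 u; rewrite /= ffunE f0.
Qed.

Lemma zero_clonoid_min i M :
  clonoids_at p i M -> (zero_clonoid i `<=` M)%classic.
Proof.
move=> clM [n f] f0; have := clonoid0 clM n.
by congr (members M n _); apply/ffunP => u; rewrite ffunE -(f0 u).
Qed.

(* On the points with residues 0 modulo p i, only the summand from M contributes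
   modulo p i. *)
Lemma clonoid_clone_sub i i' (M : opset i)
    (M' : opset i') n
    (f : {ffun K i n.+1 -> 'F_(p i)}) :
  (clonoid_clone M `<=` clonoid_clone M')%classic -> members M n f ->
  exists2 g, members M' n g & forall u (x := [ffun k => of_space u k]),
    f u = residue i (embed (g (to_space i' x))).
Proof.
move=> MM' Mf.
have [|a [g M'g E]] := MM' (existT _ n
    [ffun x : power 'Z_s n.+1 => embed (f (to_space i x))]).
  exists (fun=> 0), f => // x; rewrite /value /= ffunE big1 ?add0r // => k _.
  by rewrite mul0r.
exists g => // u; have := congr1 (residue i) (E [ffun k => of_space u k]).
rewrite /value /= ffunE residue_embed residueD residue_sum.
rewrite big1 ?add0r => [<-|k _].
  congr (f _); rewrite -[LHS]of_spaceK; congr to_space.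
  by apply/funext => k; rewrite ffunE.
by rewrite ffunE residueM residue_of_space mulr0.
Qed.

Lemma clonoid_clone_sub_same i (M M' : opset i) :
  (clonoid_clone M `<=` clonoid_clone M')%classic -> (M `<=` M')%classic.
Proof.
move=> MM' [n f] Mf; have [g M'g fg] := clonoid_clone_sub MM' Mf.
move: M'g; congr (members M' n _); apply/ffunP => u.
rewrite fg residue_embed -[in LHS](of_spaceK u); congr (g (to_space _ _)).
by apply/funext => k; rewrite ffunE.
Qed.

Lemma clonoid_clone_sub_neq i i' (M : opset i)
    (M' : opset i') : i != i' ->
  (clonoid_clone M `<=` clonoid_clone M')%classic ->
  (M `<=` zero_clonoid i)%classic.
Proof.
move=> ii' MM' [n f] Mf u; have [g _ fg] := clonoid_clone_sub MM' Mf.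
by rewrite /value /= fg residue_embed_neq.
Qed.

(** * The two bounds *)

Lemma finite_clonoids_at i : finite_set (clonoids_at p i).
Proof.
apply: clonoids_finite => // j; apply: contraTneq (valP j) => /p_distinct ->.
by rewrite negbK.
Qed.
Local Notation L i := (fset_set (clonoids_at p i)).

Lemma zero_clonoid_in i : zero_clonoid i \in L i.
Proof.
rewrite in_fset_set ?inE; first exact: zero_clonoidP.
exact: finite_clonoids_at.
Qed.

Lemma clones_upper : finite_set (clones_above_addition s) /\
  (cardset (clones_above_addition s) <=
     \prod_(i < m) cardset (clonoids_at p i) ^ (p i).+1)%N.
Proof.
(* The levels 0, ..., p_i account for the exponent p_i + 1. The default of [insubd] is never taken
   on clones above the addition. *)
pose f (C : set (fop (power 'Z_s) 'Z_s)) :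
    {dffun forall i : 'I_m, {ffun 'I_(p i).+1 -> L i}} :=
  [ffun i => [ffun d : 'I_(p i).+1 =>
    insubd [` zero_clonoid_in i]%fset (level_clonoid C i d)]].
have f_sub C C' : clones_above_addition s C -> clones_above_addition s C' ->
    f C = f C' -> (C `<=` C')%classic.
  move=> C_add C'_add ff; apply: (clone_determined) => // i d dp.
  have inL D : clones_above_addition s D -> level_clonoid D i d \in L i.
    move=> D_add; rewrite in_fset_set ?inE; last exact: finite_clonoids_at.
    exact: level_clonoidP.
  have := congr1 (fun h : {dffun forall i : 'I_m, {ffun 'I_(p i).+1 -> L i}} =>
    val (h i (Ordinal (dp : d < (p i).+1)%N))) ff.
  by rewrite !ffunE !insubdK //; apply: inL.
have f_inj : {in clones_above_addition s &, injective f}.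
  move=> C C'; rewrite !inE => C_add C'_add ff.
  by apply/seteqP; split; apply: f_sub.
have [finC cardC] := finite_set_inj f_inj; split=> //.
apply: (leq_trans cardC); rewrite card_dep_ffun foldrE big_map big_enum /=.
by apply: leq_prod => i _; rewrite card_ffun card_ord /cardset cardfE.
Qed.

Lemma clones_lower :
  ((\sum_(i < m) (cardset (clonoids_at p i)).-1).+1
     <= cardset (clones_above_addition s))%N.
Proof.
(* [None] stands for the clone of linear functions, shared by all zero clonoids and built here at an
   arbitrary index. *)
pose T := option {i : 'I_m & (L i `\ zero_clonoid i)%fset}.
pose f (t : T) := if t is Some (existT i M) then clonoid_clone (val M)
  else clonoid_clone (zero_clonoid (Ordinal m_gt0)).
have TL i (M : (L i `\ zero_clonoid i)%fset) :
    clonoids_at p i (val M) /\ val M <> zero_clonoid i.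
  have := valP M; rewrite in_fsetD1 => /andP[/eqP M0].
  by rewrite in_fset_set ?inE //; apply: finite_clonoids_at.
have eq_index i i' (M : (L i `\ zero_clonoid i)%fset) (M' : opset i') :
    clonoids_at p i' M' ->
    clonoid_clone (val M) = clonoid_clone M' -> i = i'.
  have [clM M0] := TL i M => clM' E; apply/eqP; apply: contra_notT M0 => ii'.
  apply/seteqP; split; last exact: zero_clonoid_min.
  apply: (clonoid_clone_sub_neq ii' (M' := M')).
  by rewrite E.
have -> : (\sum_(i < m) (cardset (clonoids_at p i)).-1).+1 = #|{: T}|.
  rewrite card_option card_tagged sumnE big_map big_enum; congr _.+1.
  apply: eq_bigr => i _; rewrite /cardset -cardfE (cardfsD1 (zero_clonoid i)).
  by rewrite zero_clonoid_in.
have finC := clones_upper.1.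
apply: (leq_cardset (f := f)) => //; last first.
  case=> [[i M]|]; apply: clonoid_clone_above => //.
    by case: (TL i M).
  exact: zero_clonoidP.
have same i (M M' : opset i) :
    clonoid_clone M = clonoid_clone M' -> M = M'.
  move=> E; apply/seteqP; split; apply: (clonoid_clone_sub_same);
  by rewrite E.
have some_none i (M : (L i `\ zero_clonoid i)%fset) :
    clonoid_clone (val M) <> clonoid_clone (zero_clonoid (Ordinal m_gt0)).
  move=> E; have ii' := eq_index i _ M _ (zero_clonoidP _) E.
  by case: (TL i M) => _; case: _ / ii' E => /same.
case=> [[i M]|] [[i' M']|] //= E.
- have [clM' _] := TL i' M'; have ii' := eq_index i i' M _ clM' E.
  by case: _ / ii' M' E {clM'} => M' /same /val_inj ->.
- by case: (some_none i M).
- by case: (some_none i' M').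
Qed.

Lemma cardset_clonoids_gt0 i : (0 < cardset (clonoids_at p i))%N.
Proof.
rewrite cardfs_gt0; apply/fset0Pn; exists (zero_clonoid i).
exact: zero_clonoid_in.
Qed.

End Squarefree.

Theorem corollary1p4 (m : nat) (p : 'I_m -> nat) (s : nat)
    (m_gt0 : (0 < m)%N)
    (p_prime : forall i : 'I_m, prime (p i))
    (p_distinct : injective p)
    (s_def : s = (\prod_(i < m) p i)%N) :
  [/\ finite_set (clones_above_addition s),
      forall i : 'I_m, finite_set (clonoids_at p i),
      (\sum_(i < m) (cardset (clonoids_at p i))%:Z - m%:Z + 1
        <= (cardset (clones_above_addition s))%:Z)
    & (cardset (clones_above_addition s)
        <= \prod_(i < m) cardset (clonoids_at p i) ^ (p i).+1)%N].
Proof.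
have [finC upper] := clones_upper m_gt0 p_prime p_distinct s_def.
split=> //; first exact: finite_clonoids_at.
have lower := clones_lower m_gt0 p_prime p_distinct s_def.
(* Each cardinality is positive, so the m truncated predecessors together lose exactly m. *)
have E : (\sum_(i < m) cardset (clonoids_at p i) =
          \sum_(i < m) (cardset (clonoids_at p i)).-1 + m)%N.
  rewrite -[X in (_ + X)%N]card_ord -sum1_card -big_split /=.
  apply: eq_bigr => i _.
  by rewrite addn1 prednK //; apply: (cardset_clonoids_gt0 p_prime p_distinct).
by rewrite -(big_morph Posz PoszD (erefl _)) E; lia.
Qed.
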